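(* For every classical Poincaré-invariant system with timelike future-directed four-momentum, the Newton–Wigner position observable $$\chi^{\mathrm{NW}}_\mu(u,\tau)=-\frac{J_{\mu\rho}\big(u^\rho+\frac{P^\rho}{mc}\big)}{mc-u\cdot P}+\frac{\tau P_\mu}{(-u\cdot P)}-\frac{J_{\lambda\rho}u^\lambda P^\rho}{mc(mc-u\cdot P)}\frac{P_\mu}{(-u\cdot P)}$$ is a centre of spin position observable.
   Context: Minkowski spacetime: affine space $M$ over a 4-dimensional real vector space $V$ with metric $\eta$ of signature $(-,+,+,+)$, fixed orientation and time orientation, fixed origin identifying $M$ with $V$. $u\cdot v:=\eta(u,v)$, indices lowered/raised with $\eta$; $\varepsilon$ is the volume form with $\varepsilon_{0123}=+1$ in positively oriented orthonormal bases; $c>0$. $\mathsf{SpHP}$ is the set of spacelike hyperplanes, each identified with $(u,\tau)$, $u$ future-directed unit timelike normal, $\Sigma=\{x:u\cdot x=-\tau\}$. A classical Poincaré-invariant system has phase-space functions $P_\mu$ (four-momentum) and $J_{\mu\nu}=-J_{\nu\mu}$ (angular momentum about the origin); $m=\sqrt{-P\cdot P}/c$. A position observable is a map $\chi\colon\mathsf{SpHP}\times\Gamma\to M$ with $u_\mu\chi^\mu(u,\tau)=-\tau$ and $\partial\chi_\mu(u,\tau)/\partial\tau=P_\mu/(-u\cdot P)$; its spin tensor is $S(u)_{\mu\nu}=J_{\mu\nu}-\chi_\mu(u,\tau)P_\nu+\chi_\nu(u,\tau)P_\mu$. Pauli–Lubański vector $W_\mu=-\tfrac12\varepsilon_{\mu\nu\rho\sigma}P^\nu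 J^{\rho\sigma}$; spin vector in frame $u$: $s(u)=B(u)W/(mc)$ with $B^\mu{}_\nu(u)=\delta^\mu_\nu+\frac{(P^\mu/(mc)+u^\mu)(P_\nu/(mc)+u_\nu)}{1-u\cdot P/(mc)}-2\frac{u^\mu P_\nu}{mc}$. A position observable is a centre of spin if $s_\mu(u)=-\tfrac12\varepsilon_{\mu\nu\rho\sigma}u^\nu S^{\rho\sigma}(u)$ for all $(u,\tau)$ and all phase-space points. *)

(* Defs.v *)
From HB Require Import structures.
From mathcomp Require Import all_boot all_order all_algebra.
From mathcomp Require Import all_classical all_reals all_analysis.
Set Implicit Arguments. Unset Strict Implicit. Unset Printing Implicit Defensive.
Import Order.TTheory GRing.Theory Num.Theory.
Local Open Scope ring_scope.

(* Minkowski space V is identified with R^4 via a fixed positively oriented,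
   time-oriented orthonormal basis (e_0 timelike future-directed).
   A vector x in V (or point of M, with the fixed origin) is given by its
   contravariant components x^mu : 'I_4 -> R.
   A 2-tensor T_{mu nu} is given by its covariant components. *)

Definition vec (R : realType) := 'I_4 -> R.
Definition tens2 (R : realType) := 'I_4 -> 'I_4 -> R.

Definition eta {R : realType} (i : 'I_4) : R := if val i == 0%N then -1 else 1.

Definition mdot {R : realType} (x y : vec R) : R :=
  \sum_(i < 4) eta i * x i * y i.

Definition lower {R : realType} (x : vec R) : 'I_4 -> R := fun i => eta i * x i.

Definition raise2 {R : realType} (T : tens2 R) : tens2 R :=
  fun i j => eta i * eta j * T i j.

(* Levi-Civita symbol eps_{mu nu rho sigma}: the volume form in the positively
   oriented orthonormal basis, eps_{0123} = +1; it is the determinant of the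
   matrix whose rows are the basis vectors e_mu, e_nu, e_rho, e_sigma. *)
Definition levi {R : realType} (a b c d : 'I_4) : R :=
  let f := [tuple a; b; c; d] in
  \det (\matrix_(i < 4, j < 4) ((j == tnth f i)%:R : R)).

(* future-directed unit timelike vectors: the normals u of spacelike hyperplanes *)
Definition unit_future_timelike {R : realType} (u : vec R) : Prop :=
  mdot u u = -1 /\ 0 < u ord0.

Definition timelike_future {R : realType} (p : vec R) : Prop :=
  mdot p p < 0 /\ 0 < p ord0.

Section System.
Variables (R : realType) (c : R) (Gamma : Type).
(* P g = P^mu (four-momentum), J g = J_{mu nu} (angular momentum about origin) *)
Variables (P : Gamma -> vec R) (J : Gamma -> tens2 R).

Definition mass (g : Gamma) : R := Num.sqrt (- mdot (P g) (P g)) / c.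

(* Position observable chi : SpHP x Gamma -> M; a hyperplane is (u, tau). *)
Definition position_observable (chi : vec R -> R -> Gamma -> vec R) : Prop :=
  forall (u : vec R) (tau : R) (g : Gamma), unit_future_timelike u ->
    mdot u (chi u tau g) = - tau /\
    forall mu : 'I_4,
      is_derive tau (1 : R) (fun t : R => lower (chi u t g) mu)
        (lower (P g) mu / (- mdot u (P g))).

Definition spin_tensor (chi : vec R -> R -> Gamma -> vec R)
    (u : vec R) (tau : R) (g : Gamma) : tens2 R :=
  fun mu nu => J g mu nu - lower (chi u tau g) mu * lower (P g) nu
                         + lower (chi u tau g) nu * lower (P g) mu.

Definition PL_lower (g : Gamma) : 'I_4 -> R := fun mu =>
  - 2^-1 * \sum_(nu < 4) \sum_(rho < 4) \sum_(sg < 4)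
      levi mu nu rho sg * P g nu * raise2 (J g) rho sg.

Definition Bmat (u : vec R) (g : Gamma) (mu nu : 'I_4) : R :=
  let mc := mass g * c in
  (if mu == nu then 1 else 0)
  + (P g mu / mc + u mu) * (lower (P g) nu / mc + lower u nu)
      / (1 - mdot u (P g) / mc)
  - 2 * u mu * lower (P g) nu / mc.

Definition spin_vec (u : vec R) (g : Gamma) : vec R := fun mu =>
  \sum_(nu < 4) Bmat u g mu nu * (eta nu * PL_lower g nu) / (mass g * c).

Definition centre_of_spin (chi : vec R -> R -> Gamma -> vec R) : Prop :=
  position_observable chi /\
  forall (u : vec R) (tau : R) (g : Gamma), unit_future_timelike u ->
    forall mu : 'I_4,
      lower (spin_vec u g) mu =
      - 2^-1 * \sum_(nu < 4) \sum_(rho < 4) \sum_(sg < 4)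
          levi mu nu rho sg * u nu * raise2 (spin_tensor chi u tau g) rho sg.

Definition NW_lower (u : vec R) (tau : R) (g : Gamma) : 'I_4 -> R := fun mu =>
  let mc := mass g * c in
  let uP := mdot u (P g) in
  - (\sum_(rho < 4) J g mu rho * (u rho + P g rho / mc)) / (mc - uP)
  + tau * lower (P g) mu / (- uP)
  - (\sum_(lam < 4) \sum_(rho < 4) J g lam rho * u lam * P g rho) / (mc * (mc - uP))
      * (lower (P g) mu / (- uP)).

Definition chiNW (u : vec R) (tau : R) (g : Gamma) : vec R := fun mu =>
  eta mu * NW_lower u tau g mu.

End System.

(* Main.v *)
Require Import Defs.
From HB Require Import structures.
From mathcomp Require Import all_boot all_order all_algebra.
From mathcomp Require Import all_classical all_reals all_analysis.
From mathcomp Require Import ring lra.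
Import Order.TTheory GRing.Theory Num.Theory.
Local Open Scope ring_scope.

(** Both sides of the centre-of-spin equation are values of the map
    [hodge T x = - 1/2 eps_{mu nu rho sigma} x^nu T^{rho sigma}], and the
    Pauli-Lubanski vector is [W = hodge J P].  Put [y = P + mc u].  Since
    [P . W = 0], the boost reduces to
    [B(u) W = W + y (u . W) / (mc - u . P)].  Modulo [P], which drops out of
    [chi /\ P], the Newton-Wigner position is [- J y / (mc (mc - u . P))].  The
    claim is then the identity [hodge_exchange], linear in [y], because
    [u . y = - (mc - u . P)] and [y . P = - mc (mc - u . P)]. *)

Definition hodge {R : realType} (T : tens2 R) (x : vec R) : 'I_4 -> R :=
  fun mu => - 2^-1 * \sum_(nu < 4) \sum_(rho < 4) \sum_(sg < 4)
      levi mu nu rho sg * x nu * raise2 T rho sg.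

Definition wedge {R : realType} (a b : 'I_4 -> R) : tens2 R :=
  fun i j => a i * b j - a j * b i.

Definition tens_app {R : realType} (T : tens2 R) (x : vec R) : 'I_4 -> R :=
  fun i => \sum_(j < 4) T i j * x j.

Definition covec_app {R : realType} (w : 'I_4 -> R) (x : vec R) : R :=
  \sum_(i < 4) w i * x i.

(** * Levi-Civita symbol and Hodge map in components *)

Definition o0 : 'I_4 := Ordinal (isT : (0 < 4)%N).
Definition o1 : 'I_4 := Ordinal (isT : (1 < 4)%N).
Definition o2 : 'I_4 := Ordinal (isT : (2 < 4)%N).
Definition o3 : 'I_4 := Ordinal (isT : (3 < 4)%N).

Lemma ord4_cases (Q : 'I_4 -> Prop) : Q o0 -> Q o1 -> Q o2 -> Q o3 -> forall i, Q i.
Proof.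
move=> q0 q1 q2 q3 [[|[|[|[|//]]]] lt_i4].
- by rewrite (_ : Ordinal _ = o0) //; exact: val_inj.
- by rewrite (_ : Ordinal _ = o1) //; exact: val_inj.
- by rewrite (_ : Ordinal _ = o2) //; exact: val_inj.
- by rewrite (_ : Ordinal _ = o3) //; exact: val_inj.
Qed.

Lemma sum4 (V : nmodType) (F : 'I_4 -> V) :
  \sum_(i < 4) F i = F o0 + F o1 + F o2 + F o3.
Proof.
rewrite !big_ord_recr big_ord0 /= add0r.
by congr (F _ + F _ + F _ + F _); exact: val_inj.
Qed.

(** With [nat] indices a minor is again a matrix of values of a function on [nat], so the row
    expansion can be iterated. *)
Definition nat_minor {A : Type} (F : nat -> nat -> A) (j : nat) : nat -> nat -> A :=
  fun i k => F i.+1 (bump j k).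

Lemma det_nat_matrix_recl (A : comNzRingType) n (F : nat -> nat -> A) :
  \det (\matrix_(i < n.+1, j < n.+1) F i j) =
  \sum_(j < n.+1) F 0%N j * ((-1) ^+ j *
    \det (\matrix_(i < n, k < n) nat_minor F j i k)).
Proof.
rewrite (expand_det_row _ ord0); apply: eq_bigr => j _.
by rewrite mxE /cofactor /= add0n; congr (_ * (_ * \det _)); apply/matrixP => i k; rewrite !mxE.
Qed.

Definition det3 {A : comNzRingType} (F : nat -> nat -> A) : A :=
  F 0%N 0%N * (F 1%N 1%N * F 2%N 2%N - F 1%N 2%N * F 2%N 1%N)
  - F 0%N 1%N * (F 1%N 0%N * F 2%N 2%N - F 1%N 2%N * F 2%N 0%N)
  + F 0%N 2%N * (F 1%N 0%N * F 2%N 1%N - F 1%N 1%N * F 2%N 0%N).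

Lemma det3E (A : comNzRingType) (F : nat -> nat -> A) :
  \det (\matrix_(i < 3, j < 3) F i j) = det3 F.
Proof.
rewrite !(det_nat_matrix_recl, big_ord_recr, big_ord0) /=.
rewrite !det_mx00 /nat_minor /bump /= /det3; ring.
Qed.

(** A repeated index gives two equal rows; otherwise the determinant is the sign of a permutation,
    read off as the parity of its six possible inversions. *)
Lemma leviE (R : realType) (a b c d : 'I_4) :
  levi a b c d =
    if ~~ uniq [:: val a; val b; val c; val d] then 0
    else if (b < a)%N (+) (c < a)%N (+) (d < a)%N (+) (c < b)%N (+) (d < b)%N
            (+) (d < c)%N then -1 else 1 :> R.
Proof.
(* The matrix has integer entries, and over [int] each of the 256 index choices is settled by
   evaluation; [intr] transports the result to [R]. *)
pose F (i j : nat) : int := (j == nth 0%N [:: val a; val b; val c; val d] i)%:R.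
have -> : levi a b c d = \det (map_mx intr (\matrix_(i < 4, j < 4) F i j)) :> R.
  congr (\det _); apply/matrixP => i j; rewrite !mxE /F -val_eqE /= rmorph_nat.
  by congr ((_ == _)%:R); move: i; apply: ord4_cases.
rewrite det_map_mx -(rmorph0 intr) -(rmorphN1 intr) -(rmorph1 intr) -!(fun_if intr).
apply: (congr1 intr); rewrite det_nat_matrix_recl !big_ord_recr big_ord0 /= !det3E {}/F.
by move: a b c d; do 4!apply: ord4_cases.
Qed.

(** The two orders of [rho] and [sg] contribute equally and absorb the factor 1/2; raising an index
    0 changes the sign of [T o0 i]. *)
Lemma hodgeE (R : realType) (T : tens2 R) (x : vec R) (h := hodge T x) :
  (forall i j, T i j = - T j i) ->
  [/\ h o0 = - (x o1 * T o2 o3 - x o2 * T o1 o3 + x o3 * T o1 o2),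
      h o1 = - (- x o0 * T o2 o3 - x o2 * T o0 o3 + x o3 * T o0 o2),
      h o2 = - (x o0 * T o1 o3 + x o1 * T o0 o3 - x o3 * T o0 o1)
    & h o3 = - (- x o0 * T o1 o2 - x o1 * T o0 o2 + x o2 * T o0 o1)].
Proof.
move=> Tanti.
rewrite /h /hodge /raise2.
by split; rewrite !sum4 !leviE /Defs.eta /= (Tanti o1 o0) (Tanti o2 o0)
  (Tanti o3 o0) (Tanti o2 o1) (Tanti o3 o1) (Tanti o3 o2); lra.
Qed.

(** This is the Schouten identity: antisymmetrising [y] with the volume form over five indices gives
    zero in dimension 4. Contracting with [u], [p] and [T] leaves these four terms, here checked by
    components. *)
Lemma hodge_exchange (R : realType) (T : tens2 R) (u y p : vec R) (mu : 'I_4) :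
  (forall i j, T i j = - T j i) ->
  - mdot u y * hodge T p mu + lower y mu * covec_app (hodge T p) u =
  - mdot y p * hodge T u mu + hodge (wedge (tens_app T y) (lower p)) u mu.
Proof.
move=> Tanti.
have Td i : T i i = 0 by have := Tanti i i; lra.
have wanti (a b : 'I_4 -> R) i j : wedge a b i j = - wedge a b j i.
  by rewrite /wedge opprB.
have [hp0 hp1 hp2 hp3] := hodgeE _ _ p Tanti.
have [hu0 hu1 hu2 hu3] := hodgeE _ _ u Tanti.
have [hw0 hw1 hw2 hw3] := hodgeE _ _ u (wanti (tens_app T y) (lower p)).
by move: mu; apply: ord4_cases;
  rewrite /covec_app !sum4 ?hp0 ?hp1 ?hp2 ?hp3 ?hu0 ?hu1 ?hu2 ?hu3 ?hw0 ?hw1 ?hw2 ?hw3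
    /mdot /wedge /tens_app /lower !sum4 /Defs.eta /= !Td
    ?(Tanti o1 o0) ?(Tanti o2 o0) ?(Tanti o3 o0) ?(Tanti o2 o1) ?(Tanti o3 o1) ?(Tanti o3 o2); ring.
Qed.

Lemma covec_app_hodge_self (R : realType) (T : tens2 R) (p : vec R) :
  (forall i j, T i j = - T j i) -> covec_app (hodge T p) p = 0.
Proof.
move=> /(hodgeE _ _ p)[h0 h1 h2 h3].
by rewrite /covec_app sum4 h0 h1 h2 h3; ring.
Qed.

Lemma hodge_linear (R : realType) (k : R) (S A B : tens2 R) (x : vec R) (mu : 'I_4) :
  (forall i j, S i j = A i j + k * B i j) ->
  hodge S x mu = hodge A x mu + k * hodge B x mu.
Proof.
move=> SE; rewrite /hodge mulrCA -mulrDr; congr (_ * _).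
rewrite mulr_sumr -big_split; apply: eq_bigr => nu _ /=.
rewrite mulr_sumr -big_split; apply: eq_bigr => rho _ /=.
rewrite mulr_sumr -big_split; apply: eq_bigr => sg _ /=.
by rewrite /raise2 SE; ring.
Qed.

(** * The Lorentzian metric *)

Lemma eta_mul_eta (R : realType) (i : 'I_4) : Defs.eta i * Defs.eta i = 1 :> R.
Proof. by rewrite /Defs.eta; case: ifP => _; rewrite ?mulrNN mulr1. Qed.

(** Reversed Cauchy-Schwarz: if the product were nonnegative, the spatial product would dominate
    [u o0 * p o0], although each spatial part is shorter than its time component. This makes the
    denominators [- mdot u p] and [n - mdot u p] nonzero. *)
Lemma mdot_future_lt0 (R : realType) (u p : vec R) :
  unit_future_timelike u -> timelike_future p -> mdot u p < 0.
Proof.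
have o0E : ord0 = o0 by apply: val_inj.
rewrite /unit_future_timelike /timelike_future o0E /mdot !sum4 /Defs.eta /=.
move=> [uu u0] [pp p0]; rewrite ltNge; apply/negP => up.
set u2 := u o1 ^+ 2 + u o2 ^+ 2 + u o3 ^+ 2.
set p2 := p o1 ^+ 2 + p o2 ^+ 2 + p o3 ^+ 2.
set up3 := u o1 * p o1 + u o2 * p o2 + u o3 * p o3.
have u2_ge0 : 0 <= u2 by rewrite !addr_ge0 ?sqr_ge0.
have u2_lt : u2 < u o0 ^+ 2 by rewrite /u2; lra.
have p2_lt : p2 < p o0 ^+ 2 by rewrite /p2; lra.
have up_ge : u o0 * p o0 <= up3 by rewrite /up3; lra.
have cauchy : up3 ^+ 2 <= u2 * p2.
  rewrite -subr_ge0.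
  (* Lagrange's identity in three dimensions. *)
  have -> : u2 * p2 - up3 ^+ 2 = (u o1 * p o2 - u o2 * p o1) ^+ 2
      + (u o1 * p o3 - u o3 * p o1) ^+ 2 + (u o2 * p o3 - u o3 * p o2) ^+ 2.
    by rewrite /u2 /p2 /up3; ring.
  by rewrite !addr_ge0 ?sqr_ge0.
have up_sqr : (u o0 * p o0) ^+ 2 <= up3 ^+ 2.
  by rewrite ler_sqr ?nnegrE // ?(le_trans _ up_ge) // ltW ?mulr_gt0.
have : u2 * p2 < (u o0 * p o0) ^+ 2.
  rewrite exprMn; apply: le_lt_trans (_ : u2 * p o0 ^+ 2 < _).
    by rewrite ler_wpM2l // ltW.
  by rewrite ltr_pM2r // exprn_gt0.
by rewrite ltNge (le_trans up_sqr).
Qed.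

(** * The Newton-Wigner observable *)

Section NewtonWigner.
Variables (R : realType) (c : R) (Gamma : Type).
Variables (P : Gamma -> vec R) (J : Gamma -> tens2 R).
Hypothesis c_gt0 : 0 < c.
Hypothesis Janti : forall g mu nu, J g mu nu = - J g nu mu.
Hypothesis Pfut : forall g, timelike_future (P g).
Variables (u : vec R) (g : Gamma).
Hypothesis ufut : unit_future_timelike u.

Let n := mass c P g * c.
Let p := P g.
Let y : vec R := fun i => p i + n * u i.
Let k := (n * (n - mdot u p))^-1.

Lemma massME : n = Num.sqrt (- mdot p p).
Proof. by rewrite /n /mass divfK // gt_eqF. Qed.

Lemma massM_gt0 : 0 < n.
Proof. by rewrite massME sqrtr_gt0 oppr_gt0; exact: (Pfut g).1. Qed.

Lemma massM_sqr : n ^+ 2 = - mdot p p.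
Proof. by rewrite massME sqr_sqrtr // oppr_ge0 ltW //; exact: (Pfut g).1. Qed.

Let up_lt0 : mdot u p < 0. Proof. exact: (mdot_future_lt0 _ _ _ ufut (Pfut g)). Qed.
Let n_neq0 : n != 0. Proof. by rewrite gt_eqF // massM_gt0. Qed.
Let nup_neq0 : n - mdot u p != 0.
Proof. by rewrite gt_eqF // subr_gt0 (lt_trans up_lt0) // massM_gt0. Qed.

Lemma spin_vec_lowerE mu :
  lower (spin_vec c P J u g) mu =
  (hodge (J g) p mu + lower y mu * covec_app (hodge (J g) p) u / (n - mdot u p)) / n.
Proof.
pose W := hodge (J g) p.
have WP : covec_app W p = 0 by exact: covec_app_hodge_self.
rewrite /spin_vec /lower /Bmat -/n -/p.
rewrite (_ : PL_lower P J g = W) // -/W.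
(* Only a rational identity remains, so [n], [mdot u p] and [W] become atoms for [field]. *)
move: n_neq0 nup_neq0 WP; rewrite /y; move: n (mdot u p) W => m q W m0 mq0 WP.
have q0 : 1 - q / m != 0.
  have -> : 1 - q / m = (m - q) / m by field.
  by rewrite mulf_neq0 // invr_eq0.
(* Before [P . W = 0] is used, the two sides differ by [r * (P . W)]. *)
pose r := Defs.eta mu * ((p mu / m + u mu) / m / (1 - q / m) - 2 * u mu / m) / m.
rewrite -[RHS]addr0 -[X in _ = _ + X](mulr0 r) -[X in r * X]WP /r.
move: mu {r}; apply: ord4_cases; rewrite /covec_app !sum4 /lower /Defs.eta -?val_eqE /=; field.
all: by rewrite ?m0 ?q0 ?mq0.
Qed.

(** Everything parallel to [p], including all dependence on [tau], is gathered in one coefficient,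
    since it cancels in the spin tensor. *)
Lemma NW_lowerE tau mu :
  NW_lower c P J u tau g mu = - (k * tens_app (J g) y mu)
    + (tau - k * covec_app (tens_app (J g) p) u) / (- mdot u p) * lower p mu.
Proof.
have -> : covec_app (tens_app (J g) p) u =
    \sum_(i < 4) \sum_(j < 4) J g i j * u i * p j.
  rewrite /covec_app /tens_app; apply: eq_bigr => i _.
  by rewrite mulr_suml; apply: eq_bigr => j _; ring.
have yE : \sum_(j < 4) J g mu j * (u j + p j / n) = tens_app (J g) y mu / n.
  rewrite /tens_app mulr_suml; apply: eq_bigr => j _; rewrite /y; field.
  exact: n_neq0.
rewrite /NW_lower /= -/n -/p yE /k.
have q0 : mdot u p != 0 by rewrite lt_eqF.
field; by rewrite ?n_neq0 ?nup_neq0 ?q0.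
Qed.

Lemma lower_chiNW tau mu : lower (chiNW c P J u tau g) mu = NW_lower c P J u tau g mu.
Proof. by rewrite /lower /chiNW mulrA eta_mul_eta mul1r. Qed.

(** Antisymmetry kills [J] on the pair [u], [u], so [y] may be replaced by [p] in the first term;
    the last Newton-Wigner term is the one that cancels it. *)
Lemma chiNW_incident tau : mdot u (chiNW c P J u tau g) = - tau.
Proof.
have q0 : mdot u p != 0 by rewrite lt_eqF.
pose K := (tau - k * covec_app (tens_app (J g) p) u) / (- mdot u p).
have -> : mdot u (chiNW c P J u tau g) =
    - (k * covec_app (tens_app (J g) y) u) + K * mdot u p.
  rewrite /covec_app /mdot !mulr_sumr -sumrN -big_split; apply: eq_bigr => i _ /=.
  rewrite mulrAC -/(lower (chiNW c P J u tau g) i) lower_chiNW NW_lowerE -/K /lower; ring.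
have -> : covec_app (tens_app (J g) y) u = covec_app (tens_app (J g) p) u.
  have Jd i : J g i i = 0 by have := Janti g i i; lra.
  rewrite /covec_app /tens_app !sum4 /y !Jd (Janti g o1 o0) (Janti g o2 o0)
    (Janti g o3 o0) (Janti g o2 o1) (Janti g o3 o1) (Janti g o3 o2); ring.
rewrite /K; field; exact: q0.
Qed.

Lemma chiNW_derive tau mu :
  is_derive tau (1 : R) (fun t : R => lower (chiNW c P J u t g) mu)
    (lower p mu / (- mdot u p)).
Proof.
pose D := lower p mu / (- mdot u p).
pose C := NW_lower c P J u 0 g mu.
(* The position is affine in [t], with slope [D] and value [C] at 0. *)
have -> : (fun t : R => lower (chiNW c P J u t g) mu) = (fun t => t * D + C).
  apply/funext => t; rewrite lower_chiNW /C !NW_lowerE /D; ring.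
apply: is_derive_eq; rewrite /GRing.scale /= -/D.
by ring.
Qed.

Lemma chiNW_spin tau mu :
  lower (spin_vec c P J u g) mu = hodge (spin_tensor P J (chiNW c P J) u tau g) u mu.
Proof.
(* The part of the position along [p] cancels, so the spin tensor is [J] plus [k] times the wedge of
   [J y] with [p]. *)
rewrite (hodge_linear _ k _ (J g) (wedge (tens_app (J g) y) (lower p))); last first.
  move=> i j; rewrite /spin_tensor /wedge !lower_chiNW !NW_lowerE -/p; ring.
rewrite spin_vec_lowerE.
have := hodge_exchange _ (J g) u y p mu (Janti g).
have -> : mdot u y = mdot u p - n.
  (* Writing [n] as [n * - mdot u u] turns the claim into a bilinear expansion. *)
  have [uu _] := ufut; rewrite -[n]mulr1 -[1]opprK -uu.
  by rewrite /mdot /y !sum4; ring.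
have -> : mdot y p = - n * (n - mdot u p).
  rewrite mulrBr mulNr -expr2 massM_sqr.
  by rewrite /mdot /y !sum4; ring.
move=> ex.
(* Multiplied by [k], the last term here cancels the contribution of [J] itself, and the rest is the
   boosted Pauli-Lubanski vector. *)
have {ex} exE : hodge (wedge (tens_app (J g) y) (lower p)) u mu =
  (n - mdot u p) * hodge (J g) p mu + lower y mu * covec_app (hodge (J g) p) u
   - n * (n - mdot u p) * hodge (J g) u mu by lra.
rewrite exE /k; field.
by rewrite n_neq0 nup_neq0.
Qed.

End NewtonWigner.

Theorem mainTheorem3 (R : realType) (c : R) (Gamma : Type)
    (P : Gamma -> vec R) (J : Gamma -> tens2 R) :
  0 < c ->
  (forall g mu nu, J g mu nu = - J g nu mu) ->
  (forall g, timelike_future (P g)) ->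
  centre_of_spin c P J (chiNW c P J).
Proof.
move=> c_gt0 Janti Pfut; split=> [u tau g ufut | u tau g ufut mu].
  by split=> [|mu]; [exact: chiNW_incident | exact: chiNW_derive].
exact: chiNW_spin.
Qed.
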